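(* Let $d\ge4$ and let $\Omega\subseteq\mathbb{S}^{d-1}$ be a domain with $(d-1)$-dimensional surface measure $|\Omega|$. Define $$F_{\mathbb{S}^{d-1}}(\lambda):=\frac{|\Omega|}{\sigma_d}\sum_{n=0}^\infty(\lambda-\Lambda_n)_+\,k_d(n).$$ Then for every $\lambda>0$ $$F_{\mathbb{S}^{d-1}}(\lambda)>\mathrm{L}^{\mathrm{cl}}_{1,d-1}|\Omega|\lambda^{1+(d-1)/2}.$$
   Context: $\mathbb{S}^{d-1}$ is the unit sphere in $\mathbb{R}^d$, a domain is a nonempty connected open set, $\sigma_d=|\mathbb{S}^{d-1}|=2\pi^{d/2}/\Gamma(d/2)$, $x_+=\max(0,x)$, $\Lambda_n=n(n+d-2)$, and $k_d(n)=\frac1{d-2}\binom{n+d-3}{d-3}(2n+d-2)$ (the eigenvalues and multiplicities of the Laplace--Beltrami operator on $\mathbb{S}^{d-1}$). The classical constant is $\mathrm{L}^{\mathrm{cl}}_{1,d-1}=\frac1{(2\pi)^{d-1}}\int_{\mathbb{R}^{d-1}}(1-|\xi|^2)_+\,d\xi$. *)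

(* Defs.v *)
From HB Require Import structures.
From mathcomp Require Import all_boot all_order all_algebra.
From mathcomp Require Import all_classical all_reals all_analysis.

Set Implicit Arguments.
Unset Strict Implicit.
Unset Printing Implicit Defensive.

Import Order.TTheory GRing.Theory Num.Theory.
Import numFieldNormedType.Exports.

Local Open Scope classical_set_scope.
Local Open Scope ring_scope.

(* Points to be measured are [n]-tuples, which carry the product
   sigma-algebra; points for which the topology matters are row vectors. *)

Section lebesgue_tuple.
Variable R : realType.
Local Open Scope ereal_scope.

Definition tcons n (p : measurableTypeR R * n.-tuple (measurableTypeR R)) :
    n.+1.-tuple (measurableTypeR R) :=
  [tuple of p.1 :: p.2].

Lemma measurable_tcons n : measurable_fun [set: _] (@tcons n).
Proof. exact: measurable_cons. Qed.

Section step.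
Variables (n : nat)
  (mu : {sigma_finite_measure set (n.-tuple (measurableTypeR R)) -> \bar R}).

Definition lebesgue_step : set (n.+1.-tuple (measurableTypeR R)) -> \bar R :=
  pushforward ((@lebesgue_measure R) \x mu) (@tcons n).

Let step0 : lebesgue_step set0 = 0.
Proof. by rewrite /lebesgue_step /pushforward preimage_set0 measure0. Qed.

Let step_ge0 A : 0 <= lebesgue_step A.
Proof. by rewrite /lebesgue_step /pushforward measure_ge0. Qed.

Let step_sigma_additive : semi_sigma_additive lebesgue_step.
Proof.
move=> F mF tF mUF; rewrite /lebesgue_step /pushforward preimage_bigcup.
have mp A : measurable A -> measurable (@tcons n @^-1` A).
  by move=> mA; rewrite -[X in measurable X]setTI; exact: measurable_tcons.
apply: measure_semi_sigma_additive.
- by move=> k; exact: mp.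
- apply/trivIsetP => /= i j _ _ ij; rewrite -preimage_setI.
  by move/trivIsetP : tF => /(_ _ _ _ _ ij) ->//; rewrite preimage_set0.
- by rewrite -preimage_bigcup; exact: mp.
Qed.

HB.instance Definition _ := isMeasure.Build _ _ _ lebesgue_step
  step0 step_ge0 step_sigma_additive.

Let step_sigma_finite : sigma_finite setT lebesgue_step.
Proof.
have /sigma_finiteP[F1 [F1T F1nd F1oo]] :=
  sigma_finiteT (@lebesgue_measure R).
have /sigma_finiteP[F2 [F2T F2nd F2oo]] := sigma_finiteT mu.
pose G k := [set t : n.+1.-tuple (measurableTypeR R) |
  F1 k (thead t) /\ F2 k [tuple of behead t]].
have tG k : @tcons n @^-1` (G k) = F1 k `*` F2 k.
  apply/seteqP; split => -[x t] /=; rewrite /G/= /tcons/= theadE.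
    by move=> [? h]; split => //; congr (F2 k _): h; exact/val_inj.
  by move=> [? h]; split => //; congr (F2 k _): h; exact/val_inj.
exists G.
- apply/esym; rewrite -subTset => t _.
  have : setT (thead t) by [].
  rewrite F1T => -[i _ Fi].
  have : setT [tuple of behead t] by [].
  rewrite F2T => -[j _ Fj].
  exists (maxn i j) => //; split.
  + by have /subsetPset := F1nd _ _ (leq_maxl i j); exact.
  + by have /subsetPset := F2nd _ _ (leq_maxr i j); exact.
- move=> k; have [mF1 F1k] := F1oo k; have [mF2 F2k] := F2oo k; split.
    apply: measurableI.
      rewrite -[X in measurable X]setTI.
      apply: (measurable_tnth (ord0 : 'I_n.+1)) => //.
    rewrite -[X in measurable X]setTI.
    exact: measurable_behead.
  rewrite /lebesgue_step /pushforward tG product_measure1E//.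
  by rewrite lte_mul_pinfty// ge0_fin_numE.
Qed.

HB.instance Definition _ :=
  @Measure_isSigmaFinite.Build _ _ _ lebesgue_step step_sigma_finite.

End step.

(* Lebesgue measure on R^n, as the n-fold product of the one-dimensional one. *)
Fixpoint lebesgue_tuple n :
    {sigma_finite_measure set (n.-tuple (measurableTypeR R)) -> \bar R} :=
  match n return
      {sigma_finite_measure set (n.-tuple (measurableTypeR R)) -> \bar R} with
  | 0%N => dirac [tuple]
  | m.+1 => lebesgue_step (lebesgue_tuple m)
  end.

Lemma lebesgue_tuple_box n (A : 'I_n -> set (measurableTypeR R)) :
  (forall i, measurable (A i)) ->
  lebesgue_tuple n [set t | forall i, A i (tnth t i)] =
  \prod_(i < n) (@lebesgue_measure R) (A i).
Proof.
elim: n A => [A _|n IH A mA].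
  by rewrite big_ord0 /= diracE mem_set// => -[].
rewrite big_ord_recl -IH// /= /lebesgue_step /pushforward.
rewrite -product_measure1E//; last first.
  rewrite (_ : [set t | _] =
      \big[setI/setT]_(i < n) ((@tnth _ _ ^~ i) @^-1` (A (lift ord0 i)))).
    apply: bigsetI_measurable => i _; rewrite -[X in measurable X]setTI.
    exact: measurable_tnth.
  rewrite -bigcap_seq; apply/seteqP; split => t /=.
    by move=> h i _; exact: h.
  by move=> h i; apply: h; rewrite /= mem_index_enum.
congr (_ _); apply/seteqP; split => -[x t] /=.
- move=> h; split; first exact: (h ord0).
  by move=> i; have := h (lift ord0 i); rewrite /tcons/= tnthS.
- move=> [h0 h] i; case: (unliftP ord0 i) => [j|] ->; last exact: h0.
  by rewrite /tcons/= tnthS.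
Qed.

End lebesgue_tuple.

Section sphere.
Variable R : realType.

(* The library norm on row vectors is the sup norm; it only serves for the
   topology of R^n. *)
Definition enorm n (x : 'rV[R]_n) : R := Num.sqrt (\sum_(i < n) x 0 i ^+ 2).

Definition row_of_tuple n (t : n.-tuple (measurableTypeR R)) : 'rV[R]_n :=
  \row_i tnth t i.

Definition sphere d : set 'rV[R]_d := [set x | enorm x = 1].

Definition sphere_domain d (Omega : set 'rV[R]_d) : Prop :=
  [/\ Omega `<=` @sphere d, Omega !=set0, connected Omega &
      open (Omega : set (subspace (@sphere d)))].

(* Surface measure on the unit sphere through polar coordinates:
   |E| = d * Leb {r w | 0 < r <= 1, w in E}. *)
Definition surface_measure d (E : set 'rV[R]_d) : \bar R :=
  (d%:R%:E * lebesgue_tuple R d [set t |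
     exists (r : R) w,
       [/\ (0 < r <= 1)%R, E w & row_of_tuple t = (r *: w)%R]])%E.

Definition sphere_area d : \bar R := surface_measure (@sphere d).

(* Laplace--Beltrami operator on the sphere of R^d: n-th distinct eigenvalue
   and its multiplicity. *)
Definition LB_eigenvalue d n : R := n%:R * (n + d - 2)%:R.

Definition LB_multiplicity d n : R :=
  (d - 2)%:R^-1 * 'C(n + d - 3, d - 3)%:R * (2 * n + d - 2)%:R.

(* The classical constant L^cl_{1,n}. *)
Definition Lcl1 n : \bar R :=
  (((2 * pi) ^+ n)^-1%:E *
   \int[lebesgue_tuple R n]_xi
     (Num.max 0 (1 - enorm (row_of_tuple xi) ^+ 2))%:E)%E.

Definition F_sphere d (Omega : set 'rV[R]_d) (lambda : R) : \bar R :=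
  (surface_measure Omega / sphere_area d *
   \sum_(0 <= n <oo)
     (Num.max 0 (lambda - LB_eigenvalue d n) * LB_multiplicity d n)%:E)%E.

End sphere.

(* Main.v *)
Require Import Defs.
From mathcomp Require Import all_boot all_order all_algebra.
From mathcomp Require Import all_classical all_reals all_analysis.
From mathcomp Require Import measurable_realfun.
From mathcomp Require Import ring lra.
From mathcomp Require Import zify.

Import Order.TTheory GRing.Theory Num.Theory.
Import numFieldNormedType.Exports.

Local Open Scope classical_set_scope.
Local Open Scope ring_scope.

(** The surface measure of [Omega] is positive and finite, so it cancels and an
inequality between numbers remains: the Riesz mean
G(x) = sum_n (x - Lambda_n)_+ k_d(n) exceeds L x^(1 + (d-1)/2) at every x > 0,
where L is the classical constant times the area of the sphere.

The constant L is rational. Let c_n be the volume of the unit ball of R^n.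
Slicing the ball by hyperplanes and substituting r sin for the coordinate gives
c_(n+1) = c_n W_(n+1), where W_k is the integral of cos^k over
[-pi/2, pi/2]. Consecutive Wallis integrals satisfy
W_k W_(k+1) = 2 pi / (k+1), so every power of pi in c_n c_(n+1) is explicit
([ball_volume_mul]). The area of the sphere is d c_d, and the layer-cake formula
turns the integral of (1 - |xi|^2)_+ into 2 c_n / (n+2); together
L = 4 / ((d+1) (d-1)!) ([Lcl1_mul_sphere_area]).

Between two consecutive eigenvalues G is affine while the other side is convex,
so comparing at the eigenvalues is enough ([weyl_lt_partial_sum]). There the sum
telescopes: with m = d - 1 and x = Lambda_N = N (N + m - 1),
G(x) = L * N (N+1) ... (N+m-1) * (x + m (m-2) / 4).
Pairing the factors N + j and N + m - 1 - j, whose product x + j (m-1-j) is at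
least x, bounds the rising product below by x^(m/2); and since m > 2, the last
factor is larger than x ([weyl_lt_riesz_mean]). *)

(** * Riesz means of the spectrum *)

Section sums_over_eigenvalues.
Variable R : realType.
Implicit Types (p n : nat).

(** The factors n + i and n + p + 1 - i of the falling factorial are paired: each
product is n (n + p + 1) + i (p + 1 - i). *)
Lemma ffact_pairing p n :
  ((n * (n + p.+1)) ^ p.+2 <= ((n + p.+1) ^_ p.+2) ^ 2)%N.
Proof.
rewrite -[X in (_ ^ X <= _)%N]card_ord -prod_nat_const.
have E1 : ((n + p.+1) ^_ p.+2 = \prod_(i < p.+2) (n + p.+1 - i))%N.
  exact: ffact_prod.
have E2 : ((n + p.+1) ^_ p.+2 = \prod_(i < p.+2) (n + i))%N.
  rewrite E1 (reindex_inj rev_ord_inj) /=; apply: eq_bigr => i _.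
  by have := ltn_ord i; lia.
rewrite expnS expn1 {1}E1 E2 -big_split /=; apply: leq_prod => i _.
by have := ltn_ord i; nia.
Qed.

(** The number of eigenvalues up to the n-th one, with multiplicity, on the sphere
of R^(p+3). *)
Definition counting_function p n : R :=
  (2 * n + p.+2)%:R / p.+2%:R * 'C(n + p.+1, p.+1)%:R.

(** On the sphere of R^(p+3), of dimension m = p + 2, this is the value of
sum_k (x - Lambda_k)_+ k_d(k) at x = Lambda_n, summed in closed form. *)
Definition riesz_mean p n : R :=
  n%:R * 'C(n + p.+1, p.+1)%:R * (4 * LB_eigenvalue R p.+3 n + (p.+2 * p)%:R)
  / (p.+2 * p.+4)%:R.

Lemma LB_eigenvalueE p n : LB_eigenvalue R p.+3 n = n%:R * (n + p.+1)%:R.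
Proof. by rewrite /LB_eigenvalue; congr (_ * _%:R); lia. Qed.

Lemma LB_multiplicityE p n :
  LB_multiplicity R p.+3 n =
  p.+1%:R^-1 * 'C(n + p, p)%:R * (2 * n + p.+1)%:R.
Proof.
rewrite /LB_multiplicity.
have -> : (n + p.+3 - 3 = n + p)%N by lia.
have -> : (2 * n + p.+3 - 2 = 2 * n + p.+1)%N by lia.
by rewrite !subSS !subn0.
Qed.

Lemma sum_LB_multiplicity p n :
  \sum_(i < n.+1) LB_multiplicity R p.+3 i = counting_function p n.
Proof.
have bin_up k : ('C(k + p.+1, p.+1)%:R : R)
    = (k + p.+1)%:R / p.+1%:R * 'C(k + p, p)%:R.
  apply: (@mulfI _ p.+1%:R); first by rewrite pnatr_eq0.
  rewrite mulrA mulrCA mulfV ?pnatr_eq0// mulr1 -!natrM addnS.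
  by rewrite mul_bin_diag.
elim: n => [|n IH].
  rewrite big_ord1 /= LB_multiplicityE /counting_function !add0n !binn mulr1.
  by rewrite mulVf ?pnatr_eq0// mulfV ?pnatr_eq0// mulr1.
rewrite big_ord_recr /= IH LB_multiplicityE /counting_function.
have Hn : (n.+1%:R : R) * 'C(n.+1 + p, p)%:R = (n + p.+1)%:R * 'C(n + p, p)%:R.
  rewrite -!natrM; congr (_%:R).
  rewrite addSnnS; have := mul_bin_down (n + p.+1) p.
  have -> : (n + p.+1 - p = n.+1)%N by lia.
  by rewrite addnS /= => ->.
rewrite !bin_up.
have -> : ('C(n + p, p)%:R : R) = n.+1%:R * 'C(n.+1 + p, p)%:R / (n + p.+1)%:R.
  by rewrite Hn mulrAC mulfV ?mul1r // pnatr_eq0 addnS.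
rewrite !natrD ?natrM.
have pp : 0 <= (p%:R : R) by [].
have nn : 0 <= (n%:R : R) by [].
by field; rewrite ?lt0r_neq0//; lra.
Qed.

(** Summation by parts: passing from n to n + 1 adds the eigenvalue gap times the
counting function. *)
Lemma sum_riesz_mean p n :
  \sum_(i < n) (LB_eigenvalue R p.+3 n - LB_eigenvalue R p.+3 i)
     * LB_multiplicity R p.+3 i = riesz_mean p n.
Proof.
elim: n => [|n IH].
  by rewrite big_ord0 /riesz_mean !mul0r.
transitivity (riesz_mean p n +
    (LB_eigenvalue R p.+3 n.+1 - LB_eigenvalue R p.+3 n) * counting_function p n).
  rewrite -sum_LB_multiplicity mulr_sumr -IH.
  rewrite [X in _ = X + _](_ : _ = \sum_(i < n.+1)
    (LB_eigenvalue R p.+3 n - LB_eigenvalue R p.+3 i)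
     * LB_multiplicity R p.+3 i); last first.
    by rewrite big_ord_recr/= subrr mul0r addr0.
  by rewrite -big_split/=; apply: eq_bigr => i _; ring.
rewrite /riesz_mean /counting_function !LB_eigenvalueE.
have -> : ('C(n.+1 + p.+1, p.+1)%:R : R) =
    (n + p.+2)%:R * 'C(n + p.+1, p.+1)%:R / n.+1%:R.
  apply: (@mulfI _ n.+1%:R); first by rewrite pnatr_eq0.
  rewrite [RHS]mulrC mulfVK ?pnatr_eq0// -!natrM; congr (_%:R).
  rewrite addSnnS; have := mul_bin_down (n + p.+2) p.+1.
  have -> : (n + p.+2 - p.+1 = n.+1)%N by lia.
  by rewrite addnS /= => ->.
rewrite !natrD ?natrM.
have pp : 0 <= (p%:R : R) by [].
have nn : 0 <= (n%:R : R) by [].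
by field; rewrite ?lt0r_neq0//; lra.
Qed.

(** The constant is the classical one times the area of the sphere of R^(p+3). *)
Definition weyl_term p (x : R) := 4 / (p.+4 * p.+2`!)%:R * x `^ (1 + p.+2%:R / 2).

(** The ambient dimension is p + 4 >= 4 here; in dimension 3 the shift m (m - 2) / 4
vanishes and both sides agree. *)
Lemma weyl_lt_riesz_mean p n :
  weyl_term p.+1 (LB_eigenvalue R p.+4 n.+1) < riesz_mean p.+1 n.+1.
Proof.
set q := p.+1; set N := n.+1; set x := LB_eigenvalue _ _ _.
have x0 : 0 < x by rewrite /x LB_eigenvalueE mulr_gt0 // ltr0n.
set Q : R := ((N + q.+1) ^_ q.+2)%:R.
have Q0 : 0 < Q by rewrite ltr0n ffact_gt0; lia.
have QE : Q = N%:R * 'C(N + q.+1, q.+1)%:R * q.+1`!%:R.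
  rewrite /Q ffactnSr -bin_ffact addnK -!natrM; congr (_%:R); lia.
have xQ : x `^ (q.+2%:R / 2) <= Q.
  have -> : Q = (Q ^+ 2) `^ 2^-1.
    by rewrite -(powR_mulrn _ (ltW Q0)) -powRrM mulfV// powRr1 // ltW.
  rewrite powRrM (powR_mulrn _ (ltW x0)).
  apply: ge0_ler_powR; rewrite ?nnegrE ?invr_ge0 ?exprn_ge0 ?(ltW x0) ?(ltW Q0)//.
  by rewrite /x /Q LB_eigenvalueE -/q -/N -natrM -!natrX ler_nat ffact_pairing.
rewrite /weyl_term powRD; last by rewrite gt_eqF ?implybT.
rewrite (powRr1 (ltW x0)) /riesz_mean -/x.
have -> : N%:R * 'C(N + q.+1, q.+1)%:R = Q / q.+1`!%:R.
  by rewrite QE mulfK // pnatr_eq0 -lt0n fact_gt0.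
apply: (@le_lt_trans _ _ (4 / (q.+4 * q.+2`!)%:R * (x * Q))).
  rewrite ler_pM2l; last by rewrite divr_gt0// ltr0n muln_gt0 fact_gt0.
  by rewrite ler_pM2l.
rewrite -subr_gt0.
have f0 : (q.+1`!%:R : R) != 0 by rewrite pnatr_eq0 -lt0n fact_gt0.
have f1 : (q.+2%:R : R) != 0 by rewrite pnatr_eq0.
have f2 : (q.+4%:R : R) != 0 by rewrite pnatr_eq0.
rewrite (_ : _ - _ = Q * (q.+2 * q)%:R / (q.+1`! * q.+2 * q.+4)%:R).
  by rewrite divr_gt0 ?mulr_gt0 // ltr0n !muln_gt0 ?fact_gt0.
rewrite (factS q.+1); move: (q.+1`!)%N f0 => f f0; rewrite !natrM.
move: f0 f1 f2; move: (f%:R : R) (q.+2%:R : R) (q.+4%:R : R) => u v w.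
by move=> u0 v0 w0; field; rewrite u0 v0 w0.
Qed.

Lemma weyl0 p : weyl_term p 0 = 0.
Proof. by rewrite /weyl_term powR0 ?mulr0// lt0r_neq0// ltr_wpDr. Qed.

Lemma LB_eigenvalue_bracket p (x : R) : 0 < x ->
  exists n, LB_eigenvalue R p.+3 n < x <= LB_eigenvalue R p.+3 n.+1.
Proof.
move=> x0.
have ex : exists n, x <= LB_eigenvalue R p.+3 n.
  exists (Num.truncn x).+1; apply: (le_trans (ltW (truncnS_gt x))).
  by rewrite LB_eigenvalueE -natrM ler_nat leq_pmulr// addnS.
case: (ex_minnP ex) => -[|n] xn nmin.
  by move: xn; rewrite LB_eigenvalueE mul0r leNgt x0.
exists n; rewrite xn andbT ltNge; apply/negP => /nmin.
by rewrite ltnn.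
Qed.

(** Between Lambda_n and Lambda_(n+1) the Riesz mean is the chord of its values at
the two ends, whereas a convex function lies below its chord. Strictness at the
right end suffices because x > Lambda_n gives that end a positive weight; at the
left end there may be equality, when Lambda_n = 0. *)
Lemma weyl_lt_partial_sum p (x : R) : 0 < x ->
  exists n, weyl_term p.+1 x <
    \sum_(i < n) Num.max 0 (x - LB_eigenvalue R p.+4 i)
       * LB_multiplicity R p.+4 i.
Proof.
move=> x0; have [n /andP[nx xn]] := LB_eigenvalue_bracket p.+1 x x0.
exists n.+1.
set a := LB_eigenvalue R p.+4 n in nx; set b := LB_eigenvalue R p.+4 n.+1 in xn.
have ab : a < b by exact: lt_le_trans nx xn.
have a0 : 0 <= a by rewrite mulr_ge0.
have b0 : 0 <= b by rewrite mulr_ge0.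
pose t := (b - x) / (b - a).
have t01 : 0 <= t < 1.
  have ba : 0 < b - a by rewrite subr_gt0.
  by rewrite divr_ge0 ?(ltW ba) ?subr_ge0//= ltr_pdivrMr// mul1r ltrD2l ltrN2.
have xE : x = t * a + (1 - t) * b by rewrite /t; field; rewrite subr_eq0 gt_eqF.
have phi : x `^ (1 + p.+3%:R / 2) <=
    t * a `^ (1 + p.+3%:R / 2) + (1 - t) * b `^ (1 + p.+3%:R / 2).
  have /andP[t0 t1] := t01.
  rewrite {1}xE.
  have p1 : (1 : R) <= 1 + p.+3%:R / 2 by rewrite lerDl.
  by apply: (convex_powR p1 (Itv01 t0 (ltW t1))) => /=;
    rewrite inE/= in_itv/= andbT.
have le_a : weyl_term p.+1 a <= riesz_mean p.+1 n.
  rewrite /a; case: (n) => [|k]; last exact/ltW/weyl_lt_riesz_mean.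
  by rewrite LB_eigenvalueE mul0r weyl0 /riesz_mean !mul0r.
have lt_b : weyl_term p.+1 b < riesz_mean p.+1 n.+1 := weyl_lt_riesz_mean p n.
have le_x : weyl_term p.+1 x <= t * weyl_term p.+1 a + (1 - t) * weyl_term p.+1 b.
  rewrite /weyl_term !(mulrCA t) !(mulrCA (1 - t)) -mulrDr ler_wpM2l//.
apply: (le_lt_trans le_x).
apply: (@lt_le_trans _ _ (t * riesz_mean p.+1 n + (1 - t) * riesz_mean p.+1 n.+1)).
  move/andP : t01 => [t0 t1].
  by rewrite ler_ltD// ?ler_wpM2l// ltr_pM2l// subr_gt0.
rewrite -!sum_riesz_mean.
rewrite [X in t * X](_ : _ = \sum_(i < n.+1)
    (LB_eigenvalue R p.+4 n - LB_eigenvalue R p.+4 i)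
     * LB_multiplicity R p.+4 i); last first.
  by rewrite big_ord_recr/= subrr mul0r addr0.
rewrite !mulr_sumr -big_split/=; apply: ler_sum => i _.
rewrite -/a -/b (mulrA t) (mulrA (1 - t)) -mulrDl ler_wpM2r//.
  by rewrite /LB_multiplicity !mulr_ge0// invr_ge0.
rewrite le_max; apply/orP; right; rewrite xE le_eqVlt; apply/orP; left.
by apply/eqP; ring.
Qed.

End sums_over_eigenvalues.

(** * Trigonometric integrals *)

Section trigonometric_integrals.
Variable R : realType.
Local Notation mu := (@lebesgue_measure R).

Lemma derivable_oo_LRcontinuousT (F f : R -> R) (a b : R) :
  (forall x, is_derive x (1 : R) F (f x)) -> derivable_oo_LRcontinuous F a b.
Proof.
move=> dF; have cF : continuous F.
  by move=> x; apply/differentiable_continuous/derivable1_diffP; case: (dF x).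
split => [x _||]; first by case: (dF x).
- by apply: cvg_at_right_filter; exact: cF.
- by apply: cvg_at_left_filter; exact: cF.
Qed.

(** Reduction formula: the derivative of sin cos^(k+1) is
(k+2) cos^(k+2) - (k+1) cos^k. *)
Fixpoint cos_primitive k : R -> R :=
  match k with
  | 0%N => id
  | 1%N => sin
  | k'.+2 => fun x =>
    (k'.+2%:R)^-1 * (sin x * cos x ^+ k'.+1 + k'.+1%:R * cos_primitive k' x)
  end.

Lemma is_derive_cos_primitive k (x : R) :
  is_derive x (1 : R) (cos_primitive k) (cos x ^+ k).
Proof.
suff [] : is_derive x (1 : R) (cos_primitive k) (cos x ^+ k) /\
          is_derive x (1 : R) (cos_primitive k.+1) (cos x ^+ k.+1) by [].
elim: k => [|k [IH IH1]].
  by split; [rewrite expr0; exact: is_derive_id|rewrite expr1; exact: is_derive_sin].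
split; first exact: IH1.
have D : is_derive x (1 : R)
    (k.+2%:R^-1 \*: (sin * cos ^+ k.+1 + k.+1%:R \*: cos_primitive k)) _ :=
  is_deriveZ _ (is_deriveD
    (is_deriveM (is_derive_sin x) (is_deriveX k.+1 (is_derive_cos x)))
    (is_deriveZ k.+1%:R IH)).
have E0 : sin x * (k.+1%:R * cos x ^+ k * - sin x) + cos x ^+ k.+1 * cos x
    + k.+1%:R * cos x ^+ k = k.+2%:R * cos x ^+ k.+2.
  have : sin x * sin x = 1 - cos x ^+ 2 by rewrite -expr2 sin2cos2.
  rewrite !exprS -(natr1 k.+1); move: (sin x) (cos x) => s c s2.
  transitivity (- k.+1%:R * c ^+ k * (s * s) + c * c ^+ k * c + k.+1%:R * c ^+ k).
    by ring.
  by rewrite s2; ring.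
have -> : cos x ^+ k.+2 = k.+2%:R^-1 *:
   (sin x *: ((k.+1%:R * cos x ^+ k) *: - sin x) +
     cos x ^+ k.+1 *: cos x + k.+1%:R *: cos x ^+ k).
  by apply: esym; rewrite [X in _ *: X]E0; apply: mulKf; rewrite pnatr_eq0.
have E : k.+2%:R^-1 \*: (sin * cos ^+ k.+1 + k.+1%:R \*: cos_primitive k)
  = cos_primitive k.+2.
  by apply/funext => y /=; rewrite exprfctE.
by rewrite -E; move: D; rewrite exprfctE.
Qed.

Definition wallis k := cos_primitive k (pi / 2) - cos_primitive k (- (pi / 2)).

Lemma continuous_cosX k : continuous (fun x : R => cos x ^+ k).
Proof.
move=> x; apply: (@continuous_comp _ _ _ cos (fun y => y ^+ k)).
  exact: continuous_cos.
exact: exprn_continuous.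
Qed.

Lemma continuous_sqrtX k : continuous (fun s : R => Num.sqrt s ^+ k).
Proof.
move=> x; apply: (@continuous_comp _ _ _ (@Num.sqrt R) (fun y => y ^+ k)).
  exact: sqrt_continuous.
exact: exprn_continuous.
Qed.

Lemma integral_cos k :
  (\int[mu]_(x in `[(- (pi / 2) : R)%R, (pi / 2)%R]) (cos x ^+ k)%:E
    = (wallis k)%:E)%E.
Proof.
rewrite (@continuous_FTC2 _ _ (cos_primitive k)) ?EFinB//.
- by rewrite gtrN// divr_gt0// pi_gt0.
- exact/continuous_subspaceT/continuous_cosX.
- exact/derivable_oo_LRcontinuousT/is_derive_cos_primitive.
- by move=> x _; rewrite derive1E; apply: derive_val; exact: is_derive_cos_primitive.
Qed.

Lemma wallisSS k : wallis k.+2 = k.+1%:R / k.+2%:R * wallis k.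
Proof.
by rewrite /wallis /= cosN cos_pihalf !exprS !mul0r !mulr0 !add0r; ring.
Qed.

Lemma wallis0 : wallis 0 = pi.
Proof. by rewrite /wallis /=; field. Qed.

Lemma wallis1 : wallis 1 = 2.
Proof. by rewrite /wallis /= sinN sin_pihalf; ring. Qed.

(** The reduction formula makes (k+1) W_k W_(k+1) independent of k. *)
Lemma wallis_mul k : wallis k * wallis k.+1 = 2 * pi / k.+1%:R.
Proof.
elim: k => [|k IH]; first by rewrite wallis0 wallis1; field.
rewrite wallisSS mulrCA (mulrC (wallis k.+1)) IH.
have a0 : (k.+1%:R : R) != 0 by rewrite pnatr_eq0.
have b0 : (k.+2%:R : R) != 0 by rewrite pnatr_eq0.
by move: (k.+1%:R : R) (k.+2%:R : R) a0 b0 => u v u0 v0; field; rewrite u0 v0.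
Qed.

(** The radii of the slices of a ball of radius r are sqrt(r^2 - x^2); the
substitution x = r sin y turns their powers into powers of cos y. *)
Lemma integral_sqrt_slice n (r : R) : 0 < r ->
  (\int[mu]_(x in `[(- r)%R, r%R]) (Num.sqrt (r ^+ 2 - x ^+ 2) ^+ n)%:E
    = (r ^+ n.+1 * wallis n.+1)%:E)%E.
Proof.
move=> r0; pose F (x : R) : R := r * sin x.
pose G (x : R) : R := Num.sqrt (r ^+ 2 - x ^+ 2) ^+ n.
have dF x : is_derive x (1 : R) F (r * cos x).
  exact: (is_deriveZ r (is_derive_sin x)).
have F'E : F^`()%classic = fun x => r * cos x.
  by apply/funext => x; rewrite derive1E; apply: derive_val; exact: dF.
have cF' : continuous (fun x : R => r * cos x).
  by move=> x; apply: cvgM; [exact: cvg_cst|exact: continuous_cos].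
have Fa : F (- (pi / 2)) = - r by rewrite /F /= sinN sin_pihalf mulrN1.
have Fb : F (pi / 2) = r by rewrite /F /= sin_pihalf mulr1.
have p0 : 0 < (pi : R) / 2 by rewrite divr_gt0// pi_gt0.
rewrite -[X in `[X, _]%classic]Fa -[X in `[_, X]%classic]Fb.
rewrite (@integration_by_substitution_increasing _ F G).
- rewrite F'E EFinM -integral_cos -ge0_integralZl_EFin//.
  + apply: eq_integral => x; rewrite inE/= in_itv/= => xpi.
    have c0 : 0 <= cos x by exact: cos_ge0_pihalf.
    rewrite -EFinM; congr EFin; rewrite fctE /= /G /F.
    have -> : r ^+ 2 - (r * sin x) ^+ 2 = (r * cos x) ^+ 2.
      by rewrite !exprMn cos2sin2; ring.
    by rewrite sqrtr_sqr ger0_norm ?mulr_ge0 ?(ltW r0)// -exprSr exprMn.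
  + by move=> x; rewrite /= in_itv/= => xpi; rewrite lee_fin exprn_ge0// cos_ge0_pihalf.
  + apply/measurable_EFinP; apply: measurable_funTS.
    exact: continuous_measurable_fun (continuous_cosX n.+1).
  + by rewrite exprn_ge0// ltW.
- by rewrite (@le_trans _ _ 0)// ?oppr_le0 ltW.
- move=> x y xa ya xy; rewrite /F ltr_pM2l// ltr_sin//.
- by move=> x _; rewrite F'E; exact: cF'.
- by rewrite F'E; apply/cvg_ex; eexists; apply: cvg_at_right_filter; exact: cF'.
- by rewrite F'E; apply/cvg_ex; eexists; apply: cvg_at_left_filter; exact: cF'.
- exact: derivable_oo_LRcontinuousT dF.
- apply: continuous_subspaceT => x.
  apply: (@continuous_comp _ _ _ (fun x : R => r ^+ 2 - x ^+ 2)
    (fun y : R => Num.sqrt y ^+ n)).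
    by apply: cvgB; [exact: cvg_cst|exact: exprn_continuous].
  exact: continuous_sqrtX.
Qed.

Lemma integral_sqrt_exp n :
  (\int[mu]_(s in `[0%R, 1%R]) (Num.sqrt s ^+ n)%:E = (2 / n.+2%:R)%:E)%E.
Proof.
pose F (s : R) : R := 2 / n.+2%:R * Num.sqrt s ^+ n.+2.
have cF : continuous F.
  by move=> x; apply: cvgM; [exact: cvg_cst|exact: continuous_sqrtX].
have dF (x : R) : 0 < x -> is_derive x (1 : R) F (Num.sqrt x ^+ n).
  move=> x0.
  have sx0 : Num.sqrt x != 0 by rewrite gt_eqF// sqrtr_gt0.
  have D := is_deriveZ (2 / n.+2%:R : R) (is_deriveX n.+2 (is_derive1_sqrt x0)).
  have E : (2 / n.+2%:R) \*: ((@Num.sqrt R) ^+ n.+2) = F.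
    by apply/funext => y /=; rewrite exprfctE.
  rewrite -E; apply: (is_derive_eq D); rewrite /GRing.scale /=.
  rewrite exprS; move: sx0; move: (Num.sqrt x) => y y0.
  have := pnatr_eq0 R n.+2; move: (n.+2%:R : R) => u u0.
  by field; rewrite u0 y0.
rewrite (@continuous_FTC2 _ _ F)//.
- by rewrite /F sqrtr1 sqrtr0 expr0n expr1n /= mulr0 mulr1 sube0.
- exact/continuous_subspaceT/continuous_sqrtX.
- split.
  + by move=> x; rewrite in_itv/= => /andP[x0 _]; case: (dF x x0).
  + by apply: cvg_at_right_filter; exact: cF.
  + by apply: cvg_at_left_filter; exact: cF.
- move=> x; rewrite in_itv/= => /andP[x0 _].
  by rewrite derive1E; apply: derive_val; exact: dF.
Qed.

End trigonometric_integrals.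

(** * Volume of the unit ball *)

Section ball_volume.
Variable R : realType.
Local Notation mu := (@lebesgue_measure R).

Definition sqnorm n (t : n.-tuple (measurableTypeR R)) : R :=
  \sum_(i < n) tnth t i ^+ 2.

(** Balls are indexed by the square of their radius, which makes the index of a
slice a polynomial in the coordinate; for a negative index the ball is empty. *)
Definition sqball n (s : R) : set (n.-tuple (measurableTypeR R)) :=
  [set t | sqnorm n t <= s].

Lemma sqnorm_ge0 n (t : n.-tuple (measurableTypeR R)) : 0 <= sqnorm n t.
Proof. by apply: sumr_ge0 => i _; exact: sqr_ge0. Qed.

Lemma sqnorm_tcons n (x : R) (t : n.-tuple (measurableTypeR R)) :
  sqnorm n.+1 (tcons (x, t)) = x ^+ 2 + sqnorm n t.
Proof.
rewrite /sqnorm big_ord_recl /tcons /=; congr (_ + _).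
by apply: eq_bigr => i _; rewrite tnthS.
Qed.

Lemma enormE n (t : n.-tuple (measurableTypeR R)) :
  enorm (row_of_tuple t) = Num.sqrt (sqnorm n t).
Proof.
by rewrite /enorm /sqnorm; congr Num.sqrt; apply: eq_bigr => i _; rewrite mxE.
Qed.

Lemma measurable_sqnorm n : measurable_fun [set: _] (sqnorm n).
Proof.
apply: measurable_sum => i; apply: measurable_funX; exact: measurable_tnth.
Qed.

Lemma measurable_sqball n s : measurable (sqball n s).
Proof.
rewrite -[X in measurable X]setTI.
have -> : sqball n s = sqnorm n @^-1` `]-oo, s].
  by apply/seteqP; split => t /=; rewrite /sqball /= in_itv.
exact: measurable_sqnorm.
Qed.

Fixpoint ball_volume n : R :=
  if n is k.+1 then ball_volume k * wallis R n else 1.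

Lemma lebesgue_sqball_lt0 n s : s < 0 ->
  lebesgue_tuple R n (sqball n s) = 0%E.
Proof.
move=> s0; rewrite (_ : sqball n s = set0) ?measure0//.
apply/seteqP; split => // t; rewrite /sqball /= => ts.
by have := le_lt_trans ts s0; rewrite ltNge sqnorm_ge0.
Qed.

Lemma lebesgue_sqballS n s : lebesgue_tuple R n.+1 (sqball n.+1 s) =
  (\int[mu]_x lebesgue_tuple R n (sqball n (s - x ^+ 2)))%E.
Proof.
rewrite /= /lebesgue_step /pushforward /product_measure1.
apply: eq_integral => x _ /=; congr (lebesgue_tuple R n _).
apply/seteqP; split => t; rewrite /xsection /sqball /= inE/= sqnorm_tcons lerBrDl//.
Qed.

Lemma wallis_ge0 k : 0 <= wallis R k.
Proof.
rewrite -lee_fin -integral_cos; apply: integral_ge0 => x /=.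
by rewrite in_itv /= => xpi; rewrite lee_fin exprn_ge0// cos_ge0_pihalf.
Qed.

Lemma ball_volume_ge0 n : 0 <= ball_volume n.
Proof. by elim: n => // n IH; rewrite mulr_ge0 ?wallis_ge0. Qed.

(** Each step n to n + 1 multiplies the left side by W_(n+1) W_(n+2), that
is by 2 pi / (n+2). *)
Lemma ball_volume_mul n :
  ball_volume n * ball_volume n.+1 = 2 * (2 * pi) ^+ n / n.+1`!%:R.
Proof.
elim: n => [|n IH].
  by rewrite /= wallis1 !mul1r expr0 mulr1 divr1.
have -> : ball_volume n.+1 * ball_volume n.+2 =
    ball_volume n * ball_volume n.+1 * (wallis R n.+1 * wallis R n.+2).
  by rewrite /=; ring.
rewrite IH wallis_mul (factS n.+1) natrM exprS invfM; ring.
Qed.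

(** The Wallis integrals are clearly nonnegative; that none vanishes follows from
the product formula. *)
Lemma ball_volume_gt0 n : 0 < ball_volume n.
Proof.
have : 0 < ball_volume n * ball_volume n.+1.
  rewrite ball_volume_mul divr_gt0 ?ltr0n ?fact_gt0//.
  by rewrite mulr_gt0// exprn_gt0// mulr_gt0// pi_gt0.
rewrite lt0r => /andP[+ _]; rewrite mulf_eq0 negb_or => /andP[n0 _].
by rewrite lt0r n0 ball_volume_ge0.
Qed.

Lemma lebesgue_sqball n s : 0 <= s ->
  lebesgue_tuple R n (sqball n s) = (ball_volume n * Num.sqrt s ^+ n)%:E.
Proof.
elim: n s => [|n IH] s s0.
  rewrite /= diracE mem_set ?mulr1// /sqball /= /sqnorm big_ord0//.
rewrite lebesgue_sqballS; set r := Num.sqrt s.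
have sE : s = r ^+ 2 by rewrite sqr_sqrtr.
have r0 : 0 <= r by exact: sqrtr_ge0.
(* The slices outside [-r, r] are empty. *)
transitivity (\int[mu]_(x in `[(- r)%R, r])
   ((ball_volume n)%:E * (Num.sqrt (r ^+ 2 - x ^+ 2) ^+ n)%:E))%E.
  rewrite [RHS]integral_mkcond; apply: eq_integral => x _.
  rewrite patchE; case: ifPn; rewrite ?inE ?notin_setE /= in_itv /= -ler_norml => xr.
    rewrite IH sE ?EFinM// subr_ge0.
    by rewrite -(real_normK (num_real x)) ler_pXn2r.
  apply: lebesgue_sqball_lt0; rewrite sE subr_lt0 -(real_normK (num_real x)) ltr_pXn2r//.
  by rewrite ltNge; apply/negP.
have mG : measurable_fun `[(- r)%R, r]
    (fun x => (Num.sqrt (r ^+ 2 - x ^+ 2) ^+ n)%:E).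
  apply/measurable_EFinP; apply: measurable_funTS.
  apply: continuous_measurable_fun => x.
  apply: (@continuous_comp _ _ _ (fun x : R => r ^+ 2 - x ^+ 2)
    (fun y : R => Num.sqrt y ^+ n)).
    by apply: cvgB; [exact: cvg_cst|exact: exprn_continuous].
  exact: continuous_sqrtX.
rewrite ge0_integralZl_EFin ?ball_volume_ge0//.
have [->|rn0] := eqVneq r 0.
  by rewrite oppr0 set_itv1 integral_set1 mule0 expr0n /= mulr0.
rewrite integral_sqrt_slice; last by rewrite lt0r rn0.
by rewrite -EFinM /=; congr EFin; ring.
Qed.

(** Layer cake: (1 - |xi|^2)_+ is the length of the interval [|xi|^2, 1], so the
integral is the measure of the region |xi|^2 <= s <= 1. Slicing that region at
fixed s instead gives balls of squared radius s. *)
Lemma integral_one_sub_sqnorm n :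
  (\int[lebesgue_tuple R n]_xi (Num.max 0 (1 - sqnorm n xi))%:E =
   (ball_volume n * (2 / n.+2%:R))%:E)%E.
Proof.
pose A := [set p : measurableTypeR R * n.-tuple (measurableTypeR R) |
  sqnorm n p.2 <= p.1 <= 1].
have mA : measurable A.
  have mf : measurable_fun [set: measurableTypeR R * n.-tuple (measurableTypeR R)]
      (fun p => (sqnorm n p.2 <= p.1) && (p.1 <= 1)).
    apply: measurable_and; apply: measurable_fun_ler => //.
    exact: measurableT_comp (measurable_sqnorm n) measurable_snd.
  by have := mf measurableT [set true]; rewrite setTI; exact.
have := @indic_fubini_tonelli _ _ _ _ R mu (lebesgue_tuple R n) A mA.
rewrite indic_fubini_tonelli_FE// indic_fubini_tonelli_GE// => FG.
transitivity (\int[lebesgue_tuple R n]_xi (mu \o ysection A) xi)%E.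
  apply: eq_integral => t _ /=.
  have -> : ysection A t = `[sqnorm n t, 1]%classic.
    by apply/seteqP; split => x; rewrite /ysection /A /= inE/= in_itv.
  rewrite lebesgue_measure_itv /= lte_fin.
  have [t1|t1] := ltP (sqnorm n t) 1.
    by rewrite max_r ?subr_ge0 ?EFinB// ltW.
  by rewrite max_l// subr_le0.
rewrite -FG.
have mG : measurable_fun (`[0%R, 1%R]%classic : set R) (fun s : R => (Num.sqrt s ^+ n)%:E).
  apply/measurable_EFinP; apply: measurable_funTS.
  exact: continuous_measurable_fun (continuous_sqrtX R n).
rewrite EFinM -integral_sqrt_exp -ge0_integralZl_EFin ?ball_volume_ge0//.
rewrite [RHS]integral_mkcond; apply: eq_integral => x _ /=.
rewrite patchE; case: ifPn; rewrite ?inE ?notin_setE /= in_itv /=.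
  move=> /andP[x0 x1]; rewrite -EFinM -lebesgue_sqball//; congr (lebesgue_tuple R n _).
  by apply/seteqP; split => t; rewrite /xsection /A /= inE/= x1 andbT.
move=> x01; have [x0|x0] := ltP x 0.
  rewrite -[RHS](lebesgue_sqball_lt0 n _ x0); congr (lebesgue_tuple R n _).
  apply/seteqP; split => t; rewrite /xsection /A /sqball /= inE/=.
    by move/andP => [].
  by move=> tx; have := le_lt_trans tx x0; rewrite ltNge sqnorm_ge0.
rewrite -[RHS](measure0 (lebesgue_tuple R n)); congr (lebesgue_tuple R n _).
apply/seteqP; split => // t; rewrite /xsection /A /= inE/= => /andP[_ x1].
by apply: x01; rewrite x0.
Qed.

End ball_volume.

(** * Cones over parts of the sphere *)

Section cone.
Variable R : realType.
Local Notation rtuple n := (n.-tuple (measurableTypeR R)).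

Lemma measurable_box n (A : 'I_n -> set (measurableTypeR R)) :
  (forall i, measurable (A i)) ->
  measurable [set t : rtuple n | forall i, A i (tnth t i)].
Proof.
move=> mA; rewrite (_ : [set t | _] =
    \big[setI/setT]_(i < n) ((@tnth _ _ ^~ i) @^-1` (A i))).
  apply: bigsetI_measurable => i _; rewrite -[X in measurable X]setTI.
  exact: measurable_tnth.
rewrite -bigcap_seq; apply/seteqP; split => t /=.
  by move=> h i _; exact: h.
by move=> h i; apply: h; rewrite /= mem_index_enum.
Qed.

Definition cube n (c : 'I_n -> R) (e : R) : set (rtuple n) :=
  [set t | forall i, (`]c i - e, c i + e[%classic : set (measurableTypeR R)) (tnth t i)].

Lemma measurable_cube n (c : 'I_n -> R) e : measurable (cube n c e).
Proof.
have mI i : measurable (`]c i - e, c i + e[%classic : set (measurableTypeR R)).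
  exact: measurable_itv.
exact: (measurable_box n _ mI).
Qed.

Lemma lebesgue_cube_gt0 n (c : 'I_n -> R) e : 0 < e ->
  (0 < lebesgue_tuple R n (cube n c e))%E.
Proof.
move=> e0.
have mI i : measurable (`]c i - e, c i + e[%classic : set (measurableTypeR R)).
  exact: measurable_itv.
have -> := lebesgue_tuple_box mI.
rewrite (eq_bigr (fun=> (2 * e)%:E)); last first.
  move=> i _; rewrite lebesgue_measure_itv /= lte_fin.
  rewrite ifT; last by rewrite ltrBlDr -addrA ltrDl addr_gt0.
  by rewrite -EFinB; congr EFin; ring.
by rewrite prodEFin lte_fin prodr_gt0// => i _; rewrite mulr_gt0.
Qed.

Lemma open_cube n (U : set 'rV[R]_n) (t : rtuple n) :
  open U -> U (row_of_tuple t) ->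
  exists2 e, 0 < e & cube n (tnth t) e `<=` @row_of_tuple R n @^-1` U.
Proof.
move=> oU Ut; have := open_nbhs_nbhs (conj oU Ut).
rewrite -nbhs_ballE => -[e /= e0 eU]; exists e => // u tu; apply: eU.
split => // i j; rewrite !mxE /ball /=.
by have := tu j; rewrite /= in_itv /= distrC ltr_distl.
Qed.

(** The sigma-algebra on tuples is generated by the coordinates, so an open set is
exhibited as the union of the countably many rational cubes that it contains. *)
Lemma measurable_open n (U : set 'rV[R]_n) :
  open U -> measurable (@row_of_tuple R n @^-1` U).
Proof.
move=> oU.
pose Q (p : n.-tuple rat * nat) := cube n (fun i => ratr (tnth p.1 i)) p.2.+1%:R^-1.
pose S p := Q p `<=` @row_of_tuple R n @^-1` U.
have -> : @row_of_tuple R n @^-1` U = \bigcup_p (if `[< S p >] then Q p else set0).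
  apply/seteqP; split => t; last first.
    by move=> [p _]; case: ifPn => // /asboolP; exact.
  (* A cube of half-side 1/(k+1) < e/2 containing t lies in the cube of half-side e
     around t. *)
  move=> Ut; have [e e0 teU] := open_cube n U t oU Ut.
  pose k := Num.truncn (2 / e); have ke : k.+1%:R^-1 < e / 2.
    by rewrite -[ltRHS]invrK ltf_pV2 ?posrE ?invr_gt0 ?divr_gt0// invf_div truncnS_gt.
  have kp : 0 < k.+1%:R^-1 :> R by rewrite invr_gt0.
  have H i : exists q : rat, ratr q \in `]tnth t i - k.+1%:R^-1, tnth t i + k.+1%:R^-1[.
    by apply: rat_in_itvoo; rewrite ltrBlDr -addrA ltrDl addr_gt0.
  pose q := [tuple projT1 (cid (H i)) | i < n].
  have qP i : `|tnth t i - ratr (tnth q i)| < k.+1%:R^-1.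
    rewrite tnth_mktuple; case: cid => x /=.
    by rewrite in_itv /= distrC ltr_distl.
  exists (q, k) => //; rewrite ifT.
    by move=> i /=; rewrite in_itv/= -ltr_distl.
  apply/asboolP => u qu; apply: teU => i; have /= := qu i; rewrite !in_itv /= -!ltr_distl.
  move=> ui; rewrite (le_lt_trans (ler_distD (ratr (tnth q i)) _ _))//.
  rewrite (distrC _ (tnth t i)) [ltRHS]splitr ltrD//.
    exact: lt_trans ui ke.
  exact: lt_trans (qP i) ke.
apply: countable_bigcupT_measurable => [|p]; first exact: countableP.
by case: ifPn => // _; exact: measurable_cube.
Qed.

(** The set whose volume defines the surface measure of [E]. *)
Definition cone n (E : set 'rV[R]_n) : set (rtuple n) :=
  [set t | exists r w, [/\ (0 < r <= 1)%R, E w & row_of_tuple t = (r *: w)%R]].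

Definition inv_norm n (t : rtuple n) : R := (Num.sqrt (sqnorm R n t))^-1.

Definition direction n (t : rtuple n) : rtuple n :=
  [tuple inv_norm n t * tnth t i | i < n].

Lemma row_direction n (t : rtuple n) :
  row_of_tuple (direction n t) = inv_norm n t *: row_of_tuple t.
Proof. by apply/rowP => i; rewrite !mxE tnth_mktuple. Qed.

Lemma measurable_direction n : measurable_fun [set: _] (direction n).
Proof.
apply/measurable_fun_tnthP => i.
(* As a power, the inverse norm is a measurable function, the origin included. *)
have -> : (@tnth n (measurableTypeR R))^~ i \o direction n =
   (fun t : rtuple n => sqnorm R n t `^ (- 2^-1) * tnth t i).
  apply/funext => t /=; rewrite tnth_mktuple /inv_norm powRN -powR12_sqrt//.
  exact: sqnorm_ge0.
apply: measurable_funM; last exact: measurable_tnth.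
exact: measurableT_comp (measurable_powR _) (measurable_sqnorm R n).
Qed.

Lemma enormZ n (r : R) (w : 'rV[R]_n) : 0 <= r -> enorm (r *: w) = r * enorm w.
Proof.
move=> r0; rewrite /enorm.
under eq_bigr do rewrite mxE exprMn.
by rewrite -mulr_sumr sqrtrM ?sqr_ge0// sqrtr_sqr ger0_norm.
Qed.

(** In this form the cone is visibly measurable: a punctured ball cut by the
preimage of an open set under a measurable map. *)
Lemma coneE n (U : set 'rV[R]_n) : cone n (U `&` @sphere R n) =
  (sqball R n 1 `\` sqball R n 0) `&` direction n @^-1` (@row_of_tuple R n @^-1` U).
Proof.
apply/seteqP; split => t.
  move=> [r [w [/andP[r0 r1] [Uw sw] tE]]].
  have tr : Num.sqrt (sqnorm R n t) = r.
    by rewrite -enormE tE enormZ ?ltW// sw mulr1.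
  have qr : sqnorm R n t = r ^+ 2 by rewrite -tr sqr_sqrtr// sqnorm_ge0.
  split; last first.
    rewrite /= row_direction tE /inv_norm tr scalerA mulVf ?scale1r//.
    by rewrite gt_eqF.
  split; rewrite /sqball /= qr; first by rewrite exprn_ile1// ltW.
  by apply/negP; rewrite -ltNge exprn_gt0.
move=> [[t1 /negP t0]]; rewrite /= row_direction => Ut.
rewrite /sqball /= -ltNge in t1 t0.
have n0 : 0 < Num.sqrt (sqnorm R n t) by rewrite sqrtr_gt0.
exists (Num.sqrt (sqnorm R n t)), (inv_norm n t *: row_of_tuple t); split.
- by rewrite n0 /= -sqrtr1 ler_wsqrtr.
- split => //; rewrite /sphere /= enormZ; last by rewrite invr_ge0 ltW.
  by rewrite enormE mulVf// gt_eqF.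
- by rewrite scalerA mulfV ?scale1r// gt_eqF.
Qed.

Lemma measurable_cone n (U : set 'rV[R]_n) :
  open U -> measurable (cone n (U `&` @sphere R n)).
Proof.
move=> oU; rewrite coneE; apply: measurableI.
  by apply: measurableD; exact: measurable_sqball.
rewrite -[X in measurable X]setTI; apply: measurable_direction => //.
exact: measurable_open.
Qed.

Lemma lebesgue_cone_sphere n :
  lebesgue_tuple R n.+1 (cone n.+1 (@sphere R n.+1)) = (ball_volume R n.+1)%:E.
Proof.
rewrite -[X in cone _ X]setTI coneE !preimage_setT setIT.
have -> : lebesgue_tuple R n.+1 (sqball R n.+1 1 `\` sqball R n.+1 0) =
    (lebesgue_tuple R n.+1 (sqball R n.+1 1) -
     lebesgue_tuple R n.+1 (sqball R n.+1 1 `&` sqball R n.+1 0))%E.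
  apply: measureD; [exact: measurable_sqball|exact: measurable_sqball|].
  by rewrite [ltLHS](lebesgue_sqball _ _ _ ler01) ltry.
have -> : sqball R n.+1 1 `&` sqball R n.+1 0 = sqball R n.+1 0.
  apply/setIidPr => t; rewrite /sqball /= => t0.
  by rewrite (le_trans t0).
rewrite !lebesgue_sqball// sqrtr1 expr1n mulr1.
by rewrite sqrtr0 expr0n mulr0 sube0.
Qed.

(** Radial projection is continuous at w / 2, an interior point of the solid ball,
so the cone contains a cube around that point. *)
Lemma lebesgue_cone_gt0 n (U : set 'rV[R]_n) (w : 'rV[R]_n) :
  open U -> U w -> sphere w ->
  (0 < lebesgue_tuple R n (cone n (U `&` @sphere R n)))%E.
Proof.
move=> oU Uw sw.
pose f (x : 'rV[R]_n) := (enorm x)^-1 *: x.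
pose g (x : 'rV[R]_n) := enorm x.
have cs : continuous (fun x : 'rV[R]_n => \sum_(i < n) x 0 i ^+ 2).
  apply: (@continuous_big _ _ +%R 0) => [|i _ x]; first exact: add_continuous.
  apply: (@continuous_comp _ _ _ (fun x : 'rV[R]_n => x 0 i) (fun y => y ^+ 2)).
    exact: coord_continuous.
  exact: exprn_continuous.
have cg : continuous g.
  move=> x; apply: (@continuous_comp _ _ _ _ Num.sqrt); first exact: cs.
  exact: sqrt_continuous.
pose v := 2^-1 *: w.
have gv : g v = 2^-1 by rewrite /g /v enormZ// sw mulr1.
have cgV : (g x)^-1 @[x --> v] --> (g v)^-1.
  apply: (@continuous_comp _ _ _ g GRing.inv); first exact: cg.
  by apply: inv_continuous; rewrite gv.
have cf : {for v, continuous f} := @cvgZ _ _ _ _ (nbhs_filter v) _ _ _ _ cgV (@cvg_id _ _).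
have fv : f v = w by rewrite /f -/(g v) gv invrK /v scalerA mulfV ?scale1r.
have N1 : nbhs v (f @^-1` U).
  by apply: cf; rewrite fv; exact: open_nbhs_nbhs.
have N2 : nbhs v (g @^-1` `]0, 1[).
  apply: cg; rewrite gv; apply: open_nbhs_nbhs; split; first exact: interval_open.
  by rewrite /= in_itv/= invr_gt0 ltr0n invf_lt1// ltr1n.
have [V [oV Vv] VU] :
    exists2 V, open_nbhs v V & V `<=` (f @^-1` U) `&` (g @^-1` `]0, 1[).
  have N : nbhs v ((f @^-1` U) `&` (g @^-1` `]0, 1[)) by exact: filterI.
  by move: N; rewrite nbhsE.
pose t : rtuple n := [tuple v 0 i | i < n].
have rt : row_of_tuple t = v by apply/rowP => i; rewrite mxE tnth_mktuple.
have Vt : V (row_of_tuple t) by rewrite rt.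
have [e e0 eV] := open_cube n V t oV Vt.
apply: (lt_le_trans (lebesgue_cube_gt0 n (tnth t) e e0)).
apply: le_measure.
- exact: mem_set (measurable_cube n _ _).
- exact: mem_set (measurable_cone n U oU).
- move=> u /eV /VU /= [Uu]; rewrite in_itv /= /g => /andP[u0 u1].
  exists (enorm (row_of_tuple u)), (f (row_of_tuple u)); split.
  + by rewrite u0 ltW.
  + split => //; rewrite /sphere /= /f enormZ ?mulVf ?gt_eqF//.
    by rewrite invr_ge0 ltW.
  + by rewrite /f scalerA mulfV ?scale1r// gt_eqF.
Qed.

Lemma lebesgue_cone_lty n (U : set 'rV[R]_n) :
  open U -> (lebesgue_tuple R n (cone n (U `&` @sphere R n)) < +oo)%E.
Proof.
move=> oU.
apply: (@le_lt_trans _ _ (lebesgue_tuple R n (sqball R n 1))).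
  apply: le_measure.
  - exact: mem_set (measurable_cone n U oU).
  - exact: mem_set (measurable_sqball R n 1).
  - by rewrite coneE => t [[]].
by rewrite lebesgue_sqball// ltry.
Qed.

Lemma surface_measure_domain n (Omega : set 'rV[R]_n.+1) :
  sphere_domain Omega ->
  exists2 a : R, 0 < a & surface_measure Omega = a%:E.
Proof.
move=> [Os [w Ow] _ /open_subspaceP[U oU UO]].
have OE : Omega = U `&` @sphere R n.+1 by rewrite UO; apply/esym/setIidPl.
have [Uw sw] : (U `&` @sphere R n.+1) w by rewrite -OE.
have gt := lebesgue_cone_gt0 n.+1 U w oU Uw sw.
have lt := lebesgue_cone_lty n.+1 U oU.
rewrite /surface_measure -/(cone n.+1 Omega) OE.
set m := lebesgue_tuple _ _ _ in gt lt *.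
have mfin : m \is a fin_num by rewrite ge0_fin_numE// ltW.
exists (n.+1%:R * fine m); last by rewrite EFinM fineK.
by rewrite mulr_gt0// fine_gt0// gt.
Qed.

Lemma sphere_areaE n : sphere_area R n.+1 = (n.+1%:R * ball_volume R n.+1)%:E.
Proof.
by rewrite EFinM -lebesgue_cone_sphere.
Qed.

Lemma Lcl1E n : Lcl1 R n =
  (((2 * pi) ^+ n)^-1 * (ball_volume R n * (2 / n.+2%:R)))%:E.
Proof.
rewrite /Lcl1 EFinM -integral_one_sub_sqnorm; congr (_ * _)%E.
by apply: eq_integral => t _; rewrite enormE sqr_sqrtr ?sqnorm_ge0.
Qed.

End cone.

(** * The inequality *)

Lemma Lcl1_mul_sphere_area (R : realType) n :
  ((2 * pi) ^+ n)^-1 * (ball_volume R n * (2 / n.+2%:R))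
    * (n.+1%:R * ball_volume R n.+1) = 4 / (n.+2 * n`!)%:R :> R.
Proof.
have pn0 : (2 * pi : R) ^+ n != 0 by rewrite expf_neq0// mulf_neq0// gt_eqF// pi_gt0.
transitivity (((2 * pi) ^+ n)^-1 * (2 / n.+2%:R) * n.+1%:R *
    (ball_volume R n * ball_volume R n.+1)); first by ring.
have f0 : (n`!%:R : R) != 0 by rewrite pnatr_eq0 -lt0n fact_gt0.
have n1 : (n.+1%:R : R) != 0 by rewrite pnatr_eq0.
have n2 : (n.+2%:R : R) != 0 by rewrite pnatr_eq0.
rewrite ball_volume_mul factS; move: (n`!)%N f0 => f f0; rewrite !natrM.
move: pn0 f0 n1 n2; move: (_ ^+ n) (f%:R : R) (n.+1%:R : R) (n.+2%:R : R).
by move=> q u v w q0 u0 v0 w0; field; rewrite q0 u0 v0 w0.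
Qed.

Theorem proposition4p1 (R : realType) (d : nat) (Omega : set 'rV[R]_d)
    (hd : (4 <= d)%N) (hOmega : sphere_domain Omega)
    (lambda : R) (hlambda : 0 < lambda) :
  (Lcl1 R (d - 1) * surface_measure Omega
     * (lambda `^ (1 + (d - 1)%:R / 2))%:E < F_sphere Omega lambda)%E.
Proof.
case: d hd Omega hOmega => [|[|[|[|p]]]]// _ Omega hOmega.
have [a a0 aE] := surface_measure_domain R p.+3 Omega hOmega.
have [n n_lt] := weyl_lt_partial_sum R p lambda hlambda.
rewrite subn1 /= /F_sphere aE sphere_areaE Lcl1E.
set L := (X in (X%:E * _ * _)%E); set s := (X in (_ / X%:E * _)%E).
have s0 : 0 < s by rewrite mulr_gt0 ?ball_volume_gt0.
have Ls : L * s = 4 / (p.+3.+2 * p.+3`!)%:R := Lcl1_mul_sphere_area R p.+3.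
rewrite inver gt_eqF// -!EFinM.
pose u i := (Num.max 0 (lambda - LB_eigenvalue R p.+4 i)
                 * LB_multiplicity R p.+4 i)%:E.
have u0 i : (0 <= u i)%E.
  by rewrite lee_fin /LB_multiplicity !mulr_ge0 ?le_max ?lexx ?invr_ge0.
apply: (@lt_le_trans _ _ ((a / s)%:E * \sum_(0 <= i < n) u i)%E); last first.
  apply: lee_wpmul2l; first by rewrite lee_fin divr_ge0 ?ltW.
  by apply: nneseries_lim_ge => i _ _; exact: u0.
rewrite big_mkord sumEFin -EFinM lte_fin.
have -> : L * a * lambda `^ (1 + p.+3%:R / 2) = a / s * weyl_term R p.+1 lambda.
  by rewrite /weyl_term -Ls; field; rewrite gt_eqF.
by rewrite ltr_pM2l// divr_gt0.
Qed.
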